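(* Let $D$ be a division semiring. Every strongly projective right $D$-semimodule is free. In particular, a finitely generated right $D$-semimodule $P$ is strongly projective if and only if there exists a unique nonnegative integer $n$ such that $P \cong D^n$.
   Context: A semiring $(S,+,\cdot,0,1)$ consists of a commutative monoid $(S,+,0)$ and a monoid $(S,\cdot,1)$ such that multiplication distributes over addition on both sides and $0s=0=s0$ for all $s$. It is a division semiring if $(S\setminus\{0\},\cdot,1)$ is a group. A right $S$-semimodule is a commutative monoid $(M,+,0_M)$ with a scalar multiplication $M\times S\to M$ satisfying $m(ss')=(ms)s'$, $(m+m')s=ms+m's$, $m(s+s')=ms+ms'$, $m1=m$, $0_Ms=0_M=m0$. A free right $S$-semimodule is a direct sum (coproduct) of copies of $S_S$, and a semimodule is finitely generated if it is a homomorphic image of a free semimodule with finite basis set. A right $S$-semimodule is (finitely generated) strongly projective if it is isomorphic to a direct summand of a (finitely generated) free right $S$-semimodule, i.e. $F\cong P\oplus Q$ for some (finitely generated) free $F$ and some semimodule $Q$. *)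

(* Defs.v *)
From HB Require Import structures.
From mathcomp Require Import all_boot all_algebra finmap.

Set Implicit Arguments.
Unset Strict Implicit.
Unset Printing Implicit Defensive.

Import GRing.Theory.
Local Open Scope ring_scope.

(* A right S-semimodule is a left semimodule over the converse semiring: here  *)
(* the axiom scalerA reads s *: (s' *: m) = (s' * s) *: m, the product being   *)
(* that of S, so that s *: m stands for the right action m s.                  *)
Notation rSemiModType S := (lSemiModType S^c).

(* (S \ {0}, *, 1) is a group; in particular 1 != 0. *)
Definition division_semiring (S : pzSemiRingType) : Prop :=
  [/\ (1 : S) != 0,
      forall x y : S, x != 0 -> y != 0 -> x * y != 0
    & forall x : S, x != 0 -> exists2 y : S, y != 0 & x * y = 1 /\ y * x = 1].

(* The direct sum (coproduct) V^(I) of copies of V indexed by I: finitely      *)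
(* supported functions with pointwise operations.                              *)
Definition copower (R : pzSemiRingType) (I : choiceType) (V : lSemiModType R) :=
  {fsfun I -> V with 0}.

HB.instance Definition _ (R : pzSemiRingType) I (V : lSemiModType R) :=
  Choice.copy (copower I V) {fsfun I -> V with 0}.

Section Copower.
Context (R : pzSemiRingType) (I : choiceType) (V : lSemiModType R).
Implicit Types (f g h : copower I V) (a b : R).

Definition copower0 : copower I V := [fsfun].
Definition copower_add f g : copower I V :=
  [fsfun i in (finsupp f `|` finsupp g)%fset => f i + g i].
Definition copower_scale a f : copower I V :=
  [fsfun i in finsupp f => a *: f i].

Fact copower0E i : copower0 i = 0.
Proof. by rewrite fsfun0E. Qed.

Fact copower_addE f g i : copower_add f g i = f i + g i.
Proof.
rewrite fsfunE in_fsetU; case: ifPn => //.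
by rewrite negb_or => /andP[/fsfun_dflt-> /fsfun_dflt->]; rewrite addr0.
Qed.

Fact copower_scaleE a f i : copower_scale a f i = a *: f i.
Proof. by rewrite fsfunE; case: ifPn => // /fsfun_dflt->; rewrite scaler0. Qed.

Fact copower_addA : associative copower_add.
Proof. by move=> f g h; apply/fsfunP=> i; rewrite !copower_addE addrA. Qed.

Fact copower_addC : commutative copower_add.
Proof. by move=> f g; apply/fsfunP=> i; rewrite !copower_addE addrC. Qed.

Fact copower_add0 : left_id copower0 copower_add.
Proof. by move=> f; apply/fsfunP=> i; rewrite copower_addE copower0E add0r. Qed.

HB.instance Definition _ := GRing.isNmodule.Build (copower I V)
  copower_addA copower_addC copower_add0.

Fact copower_scaleA a b f :
  copower_scale a (copower_scale b f) = copower_scale (a * b) f.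
Proof. by apply/fsfunP=> i; rewrite !copower_scaleE scalerA. Qed.

Fact copower_scale0 f : copower_scale 0 f = 0.
Proof. by apply/fsfunP=> i; rewrite copower_scaleE scale0r copower0E. Qed.

Fact copower_scale1 : left_id 1 copower_scale.
Proof. by move=> f; apply/fsfunP=> i; rewrite copower_scaleE scale1r. Qed.

Fact copower_scaleDr : right_distributive copower_scale +%R.
Proof.
move=> a f g; apply/fsfunP=> i.
by rewrite !(copower_addE, copower_scaleE) scalerDr.
Qed.

Fact copower_scaleDl f : {morph copower_scale^~ f : a b / a + b}.
Proof.
move=> a b; apply/fsfunP=> i.
by rewrite !(copower_addE, copower_scaleE) scalerDl.
Qed.

HB.instance Definition _ := GRing.Nmodule_isLSemiModule.Build R (copower I V)
  copower_scaleA copower_scale0 copower_scale1 copower_scaleDr copower_scaleDl.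

End Copower.

(* The notions below are for left semimodules over R; they are used with       *)
(* R := S^c.                                                                   *)
Section Semimodules.
Context (R : pzSemiRingType).

Definition isomorphic (P Q : lSemiModType R) : Prop :=
  exists f : {linear P -> Q}, bijective f.

Definition free_on (I : choiceType) : lSemiModType R := copower I R^o.

Definition is_free (P : lSemiModType R) : Prop :=
  exists I : choiceType, isomorphic P (free_on I).

Definition finitely_generated (P : lSemiModType R) : Prop :=
  exists (I : finType) (f : {linear free_on I -> P}),
    forall p : P, exists x, f x = p.

Definition strongly_projective (P : lSemiModType R) : Prop :=
  exists (I : choiceType) (Q : lSemiModType R),
    isomorphic (free_on I) (P * Q)%type.

Definition finite_power (n : nat) : lSemiModType R := {ffun 'I_n -> R^o}.

End Semimodules.

(* Main.v *)
(** If some nonzero element of the division semiring has an additive inverse,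
    then so does 1, and we are dealing with a division ring: every semimodule is
    a vector space, with a basis given by Zorn's lemma, and Gaussian elimination
    makes the dimension unique.  Otherwise the semiring is zerosumfree: a sum
    equal to a basis vector of a free semimodule has both terms in the line of
    that vector.  Hence in a free semimodule P + Q (direct sum) each basis vector
    lies in P or in Q, those in P form a basis of P, and an isomorphism of free
    semimodules matches the lines spanned by their basis vectors. *)

From HB Require Import structures.
Require Import Defs.
From mathcomp Require Import all_boot all_algebra finmap.
From mathcomp Require Import boolp classical_sets.

Set Implicit Arguments.
Unset Strict Implicit.
Unset Printing Implicit Defensive.

Import GRing.Theory.
Local Open Scope ring_scope.

(** * Linear maps and isomorphisms of semimodules *)

Section LinearMaps.
Context (R : pzSemiRingType).
Implicit Types U V W : lSemiModType R.

Lemma linear_of U V (f : U -> V) :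
  (forall a, {morph f : u / a *: u}) -> {morph f : u v / u + v} ->
  exists g : {linear U -> V}, g =1 f.
Proof.
move=> fZ fD.
pose lin := GRing.isSemilinear.Build R U V _ f (fZ, fD).
pose g : {linear U -> V} := HB.pack f lin.
by exists g.
Qed.

Lemma isomorphic_of_inj_surj U V (f : {linear U -> V}) :
  injective f -> (forall v, exists u, f u = v) -> isomorphic U V.
Proof.
move=> finj fsurj; exists f; have [g gE] := choice fsurj.
by exists g => // u; apply: finj; rewrite gE.
Qed.

Lemma isomorphic_sym U V : isomorphic U V -> isomorphic V U.
Proof.
case=> f [g fK gK].
have [||h hE] := @linear_of V U g.
- by move=> a v; apply: (can_inj fK); rewrite linearZ !gK.
- by move=> u v; apply: (can_inj fK); rewrite linearD !gK.
by exists h, f => u; rewrite hE ?gK ?fK.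
Qed.

Lemma isomorphic_trans U V W :
  isomorphic U V -> isomorphic V W -> isomorphic U W.
Proof.
case=> f fbij [g gbij].
have [||h hE] := @linear_of U W (g \o f).
- by move=> a u /=; rewrite !linearZ.
- by move=> u v /=; rewrite !linearD.
by exists h; apply: (eq_bij (bij_comp gbij fbij)) => u; rewrite hE.
Qed.

End LinearMaps.

(** * Coordinates and linear combinations in free semimodules *)

Section Copower.
Context (R : pzSemiRingType) (I : choiceType).
Implicit Types (f g : copower I R^o) (i j : I).

Lemma copowerD f g i : (f + g) i = f i + g i.
Proof. exact: copower_addE. Qed.

Lemma copowerZ (a : R) f i : (a *: f) i = a * f i.
Proof. exact: copower_scaleE. Qed.

Lemma copower_zero i : (0 : copower I R^o) i = 0.
Proof. exact: copower0E. Qed.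

Lemma copower_sum (J : Type) (r : seq J) (F : J -> copower I R^o) i :
  (\sum_(j <- r) F j) i = \sum_(j <- r) F j i.
Proof.
by elim/big_rec2: _ => [|j x y _ <-]; rewrite ?copower_zero ?copowerD.
Qed.

Definition copower_delta i : copower I R^o := [fsfun j in [fset i]%fset => 1].

Lemma copower_deltaE i j : copower_delta i j = if j == i then 1 else 0.
Proof. by rewrite fsfunE in_fset1. Qed.

Lemma copower_decomp f : f = \sum_(i <- finsupp f) (f i : R) *: copower_delta i.
Proof.
apply/fsfunP => j; rewrite copower_sum.
have [jf|jf] := boolP (j \in finsupp f).
  rewrite (big_fsetD1 j) //= copowerZ copower_deltaE eqxx mulr1 big_seq big1 ?addr0 //.
  move=> i; rewrite in_fsetD1 => /andP[ij _].
  by rewrite copowerZ copower_deltaE eq_sym (negbTE ij) mulr0.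
rewrite big_seq big1 ?fsfun_dflt // => i fi.
rewrite copowerZ copower_deltaE; case: eqP => [e|_]; last by rewrite mulr0.
by rewrite -e (negbTE jf) in fi.
Qed.

(** Isolates one coordinate without subtraction: [g] is [f] with its value at [j] reset to 0. *)
Lemma copower_split f j :
  exists2 g, f = (f j : R) *: copower_delta j + g
           & (finsupp g `<=` finsupp f `\ j)%fset.
Proof.
exists [fsfun i in (finsupp f `\ j)%fset => f i]; last exact: finsupp_sub.
apply/fsfunP => i.
rewrite copowerD copowerZ copower_deltaE fsfunE in_fsetD1.
case: eqP => [->|_] /=; first by rewrite mulr1 addr0.
by rewrite mulr0 add0r; case: ifPn => // /fsfun_dflt.
Qed.

Section Combination.
Context (V : lSemiModType R) (e : I -> V).

Definition combination f : V := \sum_(i <- finsupp f) (f i : R) *: e i.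

(** Terms off the support vanish, so functions with different supports can be summed over one common
    finite set. *)
Lemma combinationE (A : {fset I}) f : (finsupp f `<=` A)%fset ->
  combination f = \sum_(i <- A) (f i : R) *: e i.
Proof.
move=> fA; apply: big_fset_incl => // i _ /fsfun_dflt ->.
by rewrite scale0r.
Qed.

Lemma combinationD : {morph combination : f g / f + g}.
Proof.
move=> f g; pose A := (finsupp f `|` finsupp g `|` finsupp (f + g)%R)%fset.
rewrite !(@combinationE A) /A; first last.
- by rewrite fsubsetUr.
- by rewrite -fsetUA fsubsetUl.
- by rewrite fsetUAC fsubsetUr.
by rewrite -big_split; apply: eq_bigr => i _; rewrite copowerD scalerDl.
Qed.

Lemma combinationZ (a : R) : {morph combination : f / a *: f}.
Proof.
move=> f; pose A := (finsupp f `|` finsupp (a *: f))%fset.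
rewrite !(@combinationE A) ?fsubsetUr ?fsubsetUl // scaler_sumr.
by apply: eq_bigr => i _; rewrite copowerZ scalerA.
Qed.

Lemma combination_delta i : combination (copower_delta i) = e i.
Proof.
rewrite (@combinationE [fset i]%fset) ?finsupp_sub //.
by rewrite big_seq_fset1 copower_deltaE eqxx scale1r.
Qed.

Lemma combination_linear :
  exists g : {linear copower I R^o -> V}, g =1 combination.
Proof. exact: linear_of combinationZ combinationD. Qed.

End Combination.

Lemma linear_combination (V : lSemiModType R)
    (F : {linear copower I R^o -> V}) f :
  F f = combination (fun i => F (copower_delta i)) f.
Proof.
rewrite {1}(copower_decomp f) linear_sum.
by apply: eq_bigr => i _; rewrite linearZ.
Qed.

End Copower.

(** Transitivity of spans: choose a preimage of each [e i] that occurs and combine these with the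
    coefficients of [f]. *)
Lemma combination_surj (R : pzSemiRingType) (I J : choiceType)
    (V : lSemiModType R) (e : I -> V) (d : J -> V) (f : copower I R^o) :
  (forall i, i \in finsupp f -> exists g, combination d g = e i) ->
  exists g, combination d g = combination e f.
Proof.
move=> dP.
have [|G GE] := @choice I _ (fun i g => i \in finsupp f -> combination d g = e i).
  move=> i; have [/dP[g gE]|] := boolP (i \in finsupp f); last by exists 0.
  by exists g.
have [F FE] := combination_linear d.
exists (\sum_(i <- finsupp f) (f i : R) *: G i); rewrite -FE linear_sum.
by apply: eq_big_seq => i fi; rewrite linearZ FE GE.
Qed.

(** * Extension by zero from a subset of the basis *)

Section Extend.
Context (R : pzSemiRingType) (I : choiceType) (IP : pred I).

Definition copower_extend : copower {i | IP i} R^o -> copower I R^o :=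
  combination (fun k => copower_delta R (val k)).

Lemma copower_extend_val f k : copower_extend f (val k) = f k.
Proof.
rewrite /copower_extend {2}[f]copower_decomp /combination !copower_sum.
by apply: eq_bigr => j _; rewrite !copowerZ !copower_deltaE (inj_eq val_inj).
Qed.

Lemma copower_extend_inj : injective copower_extend.
Proof. by move=> f g fg; apply/fsfunP => k; rewrite -!copower_extend_val fg. Qed.

Lemma finsupp_copower_extend f i : i \in finsupp (copower_extend f) -> IP i.
Proof.
rewrite mem_finsupp; apply: contraR => iP.
rewrite /copower_extend /combination copower_sum big1 // => k _.
rewrite copowerZ copower_deltaE; case: eqP => [ik|_]; last by rewrite mulr0.
by rewrite ik (valP k) in iP.
Qed.

Lemma linear_copower_extend (V : lSemiModType R)
    (F : {linear copower I R^o -> V}) f :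
  F (copower_extend f) = combination (fun k => F (copower_delta R (val k))) f.
Proof.
rewrite /copower_extend /combination linear_sum.
by apply: eq_bigr => i _; rewrite linearZ.
Qed.

End Extend.

Lemma is_free_of_basis (R : pzSemiRingType) (I : choiceType)
    (V : lSemiModType R) (e : I -> V) :
  injective (combination e) -> (forall v, exists f, combination e f = v) ->
  is_free V.
Proof.
move=> einj esurj; have [F FE] := combination_linear e.
exists I; apply: isomorphic_sym; apply: (@isomorphic_of_inj_surj _ _ _ F).
  by move=> f g; rewrite !FE => /einj.
by move=> v; have [f fE] := esurj v; exists f; rewrite FE.
Qed.

Lemma free_on_finite_power (R : pzSemiRingType) (I : choiceType) n
    (h : 'I_n -> I) :
  bijective h -> isomorphic (free_on R I) (finite_power R n).
Proof.
case=> h' hK h'K.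
pose F (f : copower I R^o) : {ffun 'I_n -> R^o} := [ffun k => f (h k)].
have [||G GE] := @linear_of R (free_on R I) (finite_power R n) F.
- by move=> a f; apply/ffunP => k; rewrite !ffunE copowerZ.
- by move=> f g; apply/ffunP => k; rewrite !ffunE copowerD.
apply: (@isomorphic_of_inj_surj _ _ _ G).
  move=> f g; rewrite !GE => /ffunP fg; apply/fsfunP => i.
  by have := fg (h' i); rewrite !ffunE h'K.
move=> g.
pose f : copower I R^o :=
  [fsfun i in [fset h k | k in 'I_n]%fset => (g : {ffun 'I_n -> R^o}) (h' i)].
exists f; rewrite GE; apply/ffunP => k.
by rewrite ffunE fsfunE in_imfset //= hK.
Qed.

(** * Division semirings and the dichotomy between zerosumfree semirings and rings *)

Section DivisionSemiring.
Context (R : pzSemiRingType) (hR : division_semiring R).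

Let oneN0 : (1 : R) != 0. Proof. by case: hR. Qed.

Lemma division_semiring_inv (a : R) :
  a != 0 -> exists2 b, a * b = 1 & b * a = 1.
Proof. by case: hR => _ _ /[apply] -[b _ []]; exists b. Qed.

Lemma division_semiring_scale_eq0 (V : lSemiModType R) (a : R) (v : V) :
  a *: v = 0 -> a = 0 \/ v = 0.
Proof.
have [->|/division_semiring_inv[b _ ba] av] := eqVneq a 0; first by left.
by right; rewrite -[v]scale1r -ba -scalerA av scaler0.
Qed.

(** If [a + b = 0] with [a] nonzero, multiplying on the left by the inverse of [a] gives an additive
    inverse of 1. *)
Lemma zerosumfree_or_ring :
  (forall a b : R, a + b = 0 -> a = 0) \/ (exists m : R, 1 + m = 0).
Proof.
have [?|/existsNP[a /existsNP[b /not_implyP[ab /eqP a0]]]] :=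
  pselect (forall a b : R, a + b = 0 -> a = 0); first by left.
right; have [c _ ca] := division_semiring_inv a0.
by exists (c * b); rewrite -ca -mulrDr ab mulr0.
Qed.

Lemma copower_delta_inj (I : choiceType) (c : R) (i j : I) :
  copower_delta R i = c *: copower_delta R j -> i = j.
Proof.
move/fsfunP/(_ i); rewrite copowerZ !copower_deltaE eqxx.
by case: eqP => // _; rewrite mulr0 => /eqP; rewrite (negbTE oneN0).
Qed.

Lemma copower_delta_neq0 (I : choiceType) (i : I) : copower_delta R i <> 0.
Proof.
move/fsfunP/(_ i); rewrite copower_zero copower_deltaE eqxx.
by apply/eqP.
Qed.

(** * The zerosumfree case *)

Section Zerosumfree.
Hypothesis zsf : forall a b : R, a + b = 0 -> a = 0.

(** Away from [i] the coordinates of [x] and [y] add up to 0, so those of [x] vanish. *)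
Lemma summand_of_delta (I : choiceType) (i : I) (x y : copower I R^o) :
  x + y = copower_delta R i -> x = (x i : R) *: copower_delta R i.
Proof.
move=> xy; apply/fsfunP => j; rewrite copowerZ copower_deltaE.
case: eqP => [->|/eqP ji]; first by rewrite mulr1.
have /(congr1 (fun f : copower I R^o => f j)) := xy.
by rewrite copowerD copower_deltaE (negbTE ji) mulr0 => /zsf.
Qed.

(** The preimage of the [P]-component is a summand of the basis vector [d], hence equals [c *: d].
    Writing [phi d = (p, q)], this gives [p = c *: p] and [0 = c *: q], so [c] or [q] is zero. *)
Lemma delta_in_summand (I : choiceType) (P Q : lSemiModType R)
    (phi : {linear copower I R^o -> (P * Q)%type}) (i : I) :
  bijective phi ->
  (phi (copower_delta R i)).1 = 0 \/ (phi (copower_delta R i)).2 = 0.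
Proof.
case=> psi phiK psiK; set d := copower_delta R i.
have ed : psi ((phi d).1, 0) + psi (0, (phi d).2) = d.
  apply: (can_inj phiK); rewrite linearD !psiK.
  by case: (phi d) => p q; congr pair; rewrite /= ?addr0 ?add0r.
have /(congr1 phi) := summand_of_delta ed.
set c : R := psi _ i; rewrite linearZ psiK -/d; case: (phi d) => p q [pE qE].
case: (division_semiring_scale_eq0 (esym qE)) => [c0|]; last by right.
by left; rewrite /= pE c0 scale0r.
Qed.

Lemma is_free_zerosumfree (P : lSemiModType R) :
  strongly_projective P -> is_free P.
Proof.
case=> I [Q [phi phibij]].
(* [IP] selects the basis vectors lying in [P]; their first components [eP] will be the basis of
   [P]. *)
pose IP (i : I) := (phi (copower_delta R i)).2 == 0.
pose e (i : I) : P := (phi (copower_delta R i)).1.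
pose eP (k : {i | IP i}) := e (val k).
have phi1 (f : copower I R^o) : (phi f).1 = combination e f.
  rewrite (linear_combination phi) /combination.
  by elim/big_rec2: _ => // i x y _ <-.
have ext0 (i : {i | IP i}) : phi (copower_delta R (val i)) = (eP i, 0).
  by move: (valP i); rewrite /IP /eP /e; case: (phi _) => p q /= /eqP ->.
have phiE (f : copower {i | IP i} R^o) :
    phi (copower_extend f) = (combination eP f, 0).
  rewrite linear_copower_extend /combination; elim/big_rec2: _ => // i x y _ ->.
  by rewrite ext0; congr pair; rewrite /= ?scaler0 ?addr0.
apply: (@is_free_of_basis _ _ _ eP).
  move=> f g fg; apply: copower_extend_inj.
  by apply: (bij_inj phibij); rewrite !phiE fg.
move=> p; have [f fE] : exists f, combination e f = p.
  by case: phibij => psi _ psiK; exists (psi (p, 0)); rewrite -phi1 psiK.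
rewrite -fE; apply: combination_surj => i _.
have [iP|iP] := boolP (IP i).
  by exists (copower_delta R (Sub i iP)); rewrite combination_delta.
(* A basis vector outside [P] lies in [Q], so its first component is 0, the empty combination. *)
exists 0; case: (delta_in_summand i phibij) => [|i2]; last by rewrite /IP i2 eqxx in iP.
by rewrite /e => ->; rewrite /combination finsupp0 big_seq_fset0.
Qed.

(** Each line spanned by a basis vector is carried onto such a line, and the resulting map of
    indices is injective. *)
Lemma card_le_zerosumfree (I J : finType) :
  isomorphic (free_on R I) (free_on R J) -> (#|I| <= #|J|)%N.
Proof.
case=> phi [psi phiK psiK].
have hi (i : I) : exists j, exists c : R,
    c *: phi (copower_delta R i) = copower_delta R j.
  set d := copower_delta R i.
  have [j /eqP ji] : exists j, (phi d : copower J R^o) j <> 0.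
    apply/existsNP => z; apply: (@copower_delta_neq0 _ i).
    apply: (can_inj phiK); rewrite linear0; apply/fsfunP => j.
    by rewrite z copower_zero.
  (* Pulling [phi d = c *: copower_delta R j + g] back along [psi] makes
     [psi (c *: copower_delta R j)] a summand of [d], hence a multiple [b *: d]. *)
  have [g gE _] := copower_split (phi d : copower J R^o) j.
  set c : R := (phi d : copower J R^o) j in ji gE.
  pose b : R := (psi (c *: copower_delta R j) : copower I R^o) i.
  have /(congr1 phi) : psi (c *: copower_delta R j) = b *: d.
    apply: (@summand_of_delta _ _ _ (psi g)).
    by apply: (can_inj phiK); rewrite linearD !psiK.
  rewrite psiK linearZ => bE.
  have [a _ ac] := division_semiring_inv ji.
  by exists j, (a * b); rewrite -scalerA -bE scalerA ac scale1r.
have [h /choice[c cE]] := choice hi.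
suff hinj : injective h by apply: leq_card hinj.
move=> i i' hii'.
have ci0 : c i != 0.
  by apply/eqP => ci0; apply: (@copower_delta_neq0 _ (h i)); rewrite -cE ci0 scale0r.
have [a _ aE] := division_semiring_inv ci0.
(* With [a] inverse to [c i], equal targets make basis vector [i] the multiple [a * c i'] of basis
   vector [i']. *)
apply: (@copower_delta_inj _ (a * c i')); rewrite -scalerA.
rewrite -[LHS]scale1r -aE -scalerA; congr (a *: _).
by apply: (can_inj phiK); rewrite !linearZ; apply: etrans (cE i) _; rewrite hii' -cE.
Qed.

End Zerosumfree.

(** * The ring case: elimination, Zorn's lemma and bases *)

Section Ring.
(* [m *: v] plays the role of [- v]. *)
Context (m : R) (mE : 1 + m = 0).

Lemma addr_scale_opp (V : lSemiModType R) (v : V) : v + m *: v = 0.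
Proof. by rewrite -{1}[v]scale1r -scalerDl mE scale0r. Qed.

Lemma addr_eq0_scale_opp (V : lSemiModType R) (u v : V) :
  u + v = 0 -> u = m *: v.
Proof. by move=> uv; rewrite -[u]addr0 -(addr_scale_opp v) addrA uv add0r. Qed.

Lemma addr_scale_opp_eq0 (V : lSemiModType R) (u v : V) :
  u + m *: v = 0 -> u = v.
Proof.
move=> uv; rewrite -[u]addr0 -(addr_scale_opp v) [v + _]addrC.
by rewrite addrA uv add0r.
Qed.

(** Gaussian elimination, by induction on the list of equations; the unknowns [c i] multiply on the
    left. *)
Lemma underdetermined_system (T : finType) (J : eqType) (s : seq J)
    (A : {set T}) (v : T -> J -> R) :
  (size s < #|A|)%N ->
  exists2 c : T -> R, (exists2 i, i \in A & c i != 0)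
    & forall j, j \in s -> \sum_(i in A) c i * v i j = 0.
Proof.
elim: s A v => [|j0 s IHs] A v /= sA.
  have /card_gt0P[i iA] := sA.
  by exists (fun=> 1) => //; exists i.
have [[k kA vk]|vA] := pselect (exists2 k, k \in A & v k j0 != 0); last first.
  have [|c cn0 cE] := IHs A v; first exact: ltnW.
  exists c => // j; rewrite inE => /predU1P[->|/cE//].
  rewrite big1 // => i iA; have [->|vi] := eqVneq (v i j0) 0.
    by rewrite mulr0.
  by case: vA; exists i.
have [b _ bE] := division_semiring_inv vk.
(* Row [i] minus the multiple of the pivot row [k] that clears column [j0]; [b] is the inverse of
   the pivot. *)
pose w i j := v i j + m * v i j0 * b * v k j.
have [|c [i iA ci] cE] := IHs (A :\ k) w; first by rewrite [#|A|](cardsD1 k) kA in sA.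
move: iA; rewrite in_setD1 => /andP[ik iA].
(* The coefficient of row [k] collects all multiples of it used in forming [w], so that the solution
   for [w] becomes one for [v]. *)
pose ck := \sum_(i in A :\ k) c i * (m * v i j0 * b).
exists (fun i => if i == k then ck else c i).
  by exists i => //; rewrite (negbTE ik).
move=> j js.
have -> : \sum_(i in A) (if i == k then ck else c i) * v i j =
    \sum_(i in A :\ k) c i * w i j.
  rewrite (big_setD1 k) //= eqxx /ck mulr_suml -big_split.
  apply: eq_bigr => l; rewrite in_setD1 => /andP[/negbTE -> _].
  by rewrite /w mulrDr [RHS]addrC !mulrA.
move: js; rewrite inE => /predU1P[->|/cE//].
rewrite big1 // => l _; rewrite /w -!mulrA bE mulr1.
by rewrite (addr_scale_opp (v l j0 : R^o)) mulr0.
Qed.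

(** If [I] were larger, the coordinates of the images of the basis vectors would form an
    underdetermined system, whose nontrivial solution is a nonzero vector killed by [phi]. *)
Lemma card_le_ring (I J : finType) :
  isomorphic (free_on R I) (free_on R J) -> (#|I| <= #|J|)%N.
Proof.
case=> phi phibij; rewrite leqNgt; apply/negP => IJ.
pose v (i : I) (j : J) : R := (phi (copower_delta R i) : copower J R^o) j.
have [|c [i _ ci] cE] := @underdetermined_system I J (enum J) [set: I] v.
  by rewrite -cardE cardsT.
pose f : copower I R^o := \sum_i c i *: copower_delta R i.
have f0 : f = 0.
  apply: (bij_inj phibij); rewrite linear0 linear_sum; apply/fsfunP => j.
  rewrite copower_zero copower_sum -[RHS](cE j) ?mem_enum //.
  by apply: eq_big => [k|k _]; rewrite ?inE // linearZ copowerZ.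
move/eqP: ci; apply; rewrite -(copower_zero R i) -f0 copower_sum.
rewrite (bigD1 i) //= copowerZ copower_deltaE eqxx mulr1 big1 ?addr0 // => k ki.
by rewrite copowerZ copower_deltaE eq_sym (negbTE ki) mulr0.
Qed.

(** Of two members of the chain the larger can be kept at each step. The empty alternative is there
    because [F] itself may be empty. *)
Lemma total_on_subset_seq (T : eqType) (F : set (set T)) (s : seq T) :
  total_on F subset -> {in s, forall x, exists2 X, F X & X x} ->
  s = [::] \/ exists2 X, F X & {in s, forall x, X x}.
Proof.
move=> Ftot; elim: s => [|x s IHs] sF; [by left|right].
have [X FX Xx] := sF x (mem_head _ _).
have [|->|[Y FY sY]] := IHs.
- by move=> y ys; apply: sF; rewrite inE ys orbT.
- by exists X => // y; rewrite inE => /eqP ->.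
case: (Ftot X Y FX FY) => [XY|YX].
  by exists Y => // y; rewrite inE => /predU1P[->|/sY//]; apply: XY.
by exists X => // y; rewrite inE => /predU1P[->//|/sY]; apply: YX.
Qed.

(** Coefficients are indexed by all of [P] and confined to [B] by their support, so that different
    sets [B] can be compared without changing type. *)
Definition independent (P : lSemiModType R) (B : set P) : Prop :=
  forall f : copower P R^o, {in finsupp f, forall x, B x} ->
    combination id f = 0 -> f = 0.

(** A linear relation has finite support, so a relation in the union of a chain already lives in one
    member; Zorn's lemma applies. *)
Lemma maximal_independent (P : lSemiModType R) :
  exists2 B : set P, independent B
    & forall C, (B `<` C)%classic -> ~ independent C.
Proof.
have [|B [Bi Bmax]] := @Zorn_bigcup P (@independent P); last by exists B.
move=> F Find Ftot f fF f0.
have [|s0|[X FX fX]] := total_on_subset_seq Ftot (s := finsupp f).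
- by move=> x /fF[X]; exists X.
- apply/fsfunP => x; rewrite copower_zero fsfun_dflt //.
  by apply/negP => xf; suff : x \in [::] by []; rewrite -s0.
exact: (Find X FX f fX f0).
Qed.

Lemma is_free_ring (P : lSemiModType R) : is_free P.
Proof.
have [B Bind Bmax] := maximal_independent P.
have [L LE] := combination_linear (id : P -> P).
have Lgen p : exists2 f : copower P R^o,
    {in finsupp f, forall x, B x} & L f = p.
  have [Bp|Bp] := pselect (B p).
    exists (copower_delta R p); last by rewrite LE combination_delta.
    move=> x; rewrite mem_finsupp copower_deltaE.
    by have [->|] := eqVneq x p; rewrite ?eqxx.
  have /existsNP[f /not_implyP[fB /not_implyP[f0 fn0]]] :
      ~ independent (B `|` [set p])%classic.
    apply: Bmax; split; first by move=> x; left.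
    by move/(_ p (or_intror erefl)).
  (* In a nontrivial relation on [B] and [p] the coefficient of [p] is nonzero, since otherwise the
     relation would lie in [B]. Dividing by it expresses [p] through [B]. *)
  have [fp0|fp0] := eqVneq (f p : R) 0.
    case: fn0; apply: Bind f0 => x xf; case: (fB x xf) => // xp.
    by move: xf; rewrite xp mem_finsupp fp0 eqxx.
  have [g fE gf] := copower_split f p.
  have [b _ bE] := division_semiring_inv fp0.
  move: f0; rewrite -LE {1}fE linearD linearZ (LE (copower_delta R p)).
  rewrite combination_delta; move/addr_eq0_scale_opp => /= pE.
  exists (b *: (m *: g)); last first.
    by rewrite linearZ [L (m *: g)]linearZ /= -pE scalerA bE scale1r.
  move=> x; rewrite mem_finsupp !copowerZ => gx.
  have /(fsubsetP gf) : x \in finsupp g.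
    by rewrite mem_finsupp; apply: contraNneq gx => ->; rewrite !mulr0.
  by rewrite in_fsetD1 => /andP[/eqP xp /fB[]].
pose e (k : {x : P | `[< B x >]}) : P := val k.
have eE f : combination e f = L (copower_extend f).
  rewrite linear_copower_extend; congr combination; apply/funext => k.
  by rewrite LE combination_delta.
apply: (@is_free_of_basis _ _ _ e).
  move=> f g; rewrite !eE => fg; apply: copower_extend_inj.
  (* The difference of the two extensions, written with [m], is a relation supported in [B]. *)
  apply: addr_scale_opp_eq0; apply: Bind; last first.
    by rewrite -LE linearD linearZ fg addr_scale_opp.
  move=> x; rewrite mem_finsupp copowerD copowerZ => xfg.
  have [/finsupp_copower_extend/asboolP//|xf] :=
    boolP (x \in finsupp (copower_extend f)).
  have [/finsupp_copower_extend/asboolP//|xg] :=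
    boolP (x \in finsupp (copower_extend g)).
  by move: xfg; rewrite !fsfun_dflt // mulr0 addr0 eqxx.
move=> p; have [f fB <-] := Lgen p; rewrite LE; apply: combination_surj => x xf.
have Bx : `[< B x >] by apply/asboolP/fB.
by exists (copower_delta R (Sub x Bx)); rewrite combination_delta.
Qed.

End Ring.

(** * Both cases combined: freeness, rank and finite generation *)

Lemma is_free_strongly_projective (P : lSemiModType R) :
  strongly_projective P -> is_free P.
Proof.
have [zsf|[m mE]] := zerosumfree_or_ring; first exact: is_free_zerosumfree.
by move=> _; apply: is_free_ring mE P.
Qed.

Lemma finite_power_card_le k n :
  isomorphic (finite_power R k) (finite_power R n) -> (k <= n)%N.
Proof.
move=> kn; have freeI l : isomorphic (free_on R 'I_l) (finite_power R l).
  by apply: (@free_on_finite_power _ _ _ id); exists id.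
have {}kn : isomorphic (free_on R 'I_k) (free_on R 'I_n).
  exact: isomorphic_trans (freeI k) (isomorphic_trans kn (isomorphic_sym (freeI n))).
rewrite -[k]card_ord -[n]card_ord; move: kn.
have [zsf|[m mE]] := zerosumfree_or_ring; first exact: card_le_zerosumfree.
exact: card_le_ring mE _ _.
Qed.

Lemma free_finitely_generated (P : lSemiModType R) :
  finitely_generated P -> is_free P -> exists n, isomorphic P (finite_power R n).
Proof.
case=> K [F Fsurj] [I [phi [psi phiK psiK]]].
pose g (k : K) : copower I R^o := phi (F (copower_delta R k)).
(* The finitely many coordinates met by the generators. For an index outside [A], every image has
   coordinate 0 there, whereas surjectivity yields a basis vector with coordinate 1. *)
pose A := (\bigcup_(k <- enum K) finsupp (g k))%fset.
have memA i : i \in A.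
  apply: contraT => iA; have [x xE] := Fsurj (psi (copower_delta R i)).
  have [FD FDE] : exists G : {linear copower K R^o -> copower I R^o},
      G =1 (phi \o F : copower K R^o -> copower I R^o).
    by apply: linear_of => [a u|u v] /=; rewrite ?linearZ ?linearD.
  have := FDE x; rewrite /= xE psiK linear_combination.
  move/(congr1 (fun f : copower I R^o => f i)).
  rewrite copower_sum copower_deltaE eqxx big1 => [/esym/eqP|k _].
    by rewrite (negbTE oneN0).
  rewrite copowerZ FDE /= -/(g k) [g k i]fsfun_dflt ?mulr0 //.
  apply: contra iA => gi; apply/bigfcupP; exists k => //.
  by rewrite mem_enum.
exists #|{: A}|; apply: isomorphic_trans.
  by exists phi; exists psi.
apply: (@free_on_finite_power _ _ _ (fun k => val (enum_val k))).
exists (fun i => enum_rank [`memA i]%fset).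
  by move=> k; rewrite -[RHS]enum_valK; congr enum_rank; apply: val_inj.
by move=> i; rewrite enum_rankK.
Qed.

Lemma strongly_projective_of_finite_power (P : lSemiModType R) n :
  isomorphic P (finite_power R n) -> strongly_projective P.
Proof.
(* The complement is the zero semimodule, realised as functions on the empty ordinal. *)
move=> Pn; exists 'I_n, (finite_power R 0).
have /isomorphic_sym nP := Pn.
have : isomorphic (free_on R 'I_n) P.
  apply: isomorphic_trans nP; apply: (@free_on_finite_power _ _ _ id).
  by exists id.
case=> f [g fK gK].
have [||h hE] := @linear_of R (free_on R 'I_n) (P * finite_power R 0)%type
  (fun x => (f x, 0)).
- by move=> a x; rewrite linearZ; congr pair; rewrite /= scaler0.
- by move=> x y; rewrite linearD; congr pair; rewrite /= addr0.
exists h; exists (fun y => g y.1) => [x|[p z]]; rewrite hE ?fK //= gK.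
by congr pair; apply/ffunP => -[].
Qed.

End DivisionSemiring.

(** The axioms are left-right symmetric, which lets the results on left semimodules apply to right
    ones. *)
Lemma division_semiring_converse (D : pzSemiRingType) :
  division_semiring D -> division_semiring D^c.
Proof.
case=> D1 Dmul Dinv; split=> // [x y x0 y0|x /Dinv[y y0 [xy yx]]].
  exact: Dmul.
by exists y.
Qed.

Theorem theorem4p5 (D : pzSemiRingType) (hD : division_semiring D) :
  (forall P : rSemiModType D, strongly_projective P -> is_free P) /\
  (forall P : rSemiModType D, finitely_generated P ->
    (strongly_projective P <->
     exists! n : nat, isomorphic P (finite_power D^c n))).
Proof.
have hDc := division_semiring_converse hD; split=> [|P Pfg].
  exact: is_free_strongly_projective.
split=> [/(is_free_strongly_projective hDc) Pfree|[n [Pn _]]]; last first.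
  exact: strongly_projective_of_finite_power Pn.
have [n Pn] := free_finitely_generated hDc Pfg Pfree.
(* Uniqueness: composing the two isomorphisms in either order bounds each exponent by the other. *)
exists n; split=> // k Pk; apply/eqP; rewrite eqn_leq.
apply/andP; split; apply: (finite_power_card_le hDc).
  exact: isomorphic_trans (isomorphic_sym Pn) Pk.
exact: isomorphic_trans (isomorphic_sym Pk) Pn.
Qed.
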